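(* Let $(a_n)_{n\ge 1}$ be Cloitre's sequence, i.e., the unique sequence over the alphabet $\{1,2\}$ with $a_1=1$ such that, for every $n\ge 1$, the sum of the terms in the $n$'th run of the sequence equals $2a_n$. Let $g_n$ be the number of $1$'s in the finite sequence $a_1 a_2\cdots a_n$. Then $$0\le 3g_n-2n\le 4$$ for all $n$, and hence $\lim_{n\to\infty} g_n/n = 2/3$.
   Context: A run in a sequence is a maximal block of consecutive identical values; the runs are numbered $1,2,3,\ldots$ from left to right. Cloitre's sequence $(a_n)_{n\ge1}$ is over the alphabet $\{1,2\}$ and is indexed from $1$; it begins $1,1,2,1,1,1,1,2,1,1,2,1,1,2,2,\ldots$, with runs $(1,1),(2),(1,1,1,1),(2),(1,1),\ldots$ having sums $2,2,4,2,2,\ldots = 2a_1,2a_2,2a_3,2a_4,2a_5,\ldots$. *)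

(* Defs.v *)
From mathcomp Require Import all_boot.

Set Implicit Arguments.
Unset Strict Implicit.
Unset Printing Implicit Defensive.

(* A sequence (a_n)_{n >= 1} is a function [a : nat -> nat]; the value [a 0] is
   junk and is never used. *)

(* The half-open block of positions i, ..., j - 1 is a maximal constant block. *)
Definition is_run (a : nat -> nat) (i j : nat) : Prop :=
  [/\ 0 < i < j,
      forall k, i <= k < j -> a k = a i,
      i = 1 \/ a i.-1 <> a i
    & a j <> a i].

(* Only finite runs are numbered: an infinite last run has no end [j]. *)
Inductive nth_run (a : nat -> nat) : nat -> nat -> nat -> Prop :=
| first_run j : is_run a 1 j -> nth_run a 1 1 j
| next_run n i j k : nth_run a n i j -> is_run a j k -> nth_run a n.+1 j k.

Definition is_cloitre (a : nat -> nat) : Prop :=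
  [/\ forall n, 0 < n -> a n = 1 \/ a n = 2,
      a 1 = 1
    & forall n, 0 < n ->
        exists i j, nth_run a n i j /\ \sum_(i <= k < j) a k = 2 * a n].

Definition ones (a : nat -> nat) (n : nat) : nat :=
  count_mem 1 [seq a i | i <- iota 1 n].

(* Main.v *)
Require Import Defs.
From mathcomp Require Import all_boot all_order all_algebra.
From mathcomp Require Import all_classical all_reals all_analysis.
From mathcomp Require Import zify ring.
Import Order.TTheory GRing.Theory Num.Theory.
Import numFieldNormedType.Exports.

Set Implicit Arguments.
Unset Strict Implicit.
Unset Printing Implicit Defensive.

(** Write [B n = 3 g_n - 2 n]: each 1 adds 1 to it and each 2 subtracts 2.  Runs
    of ones and of twos alternate, starting with ones, and run [k] sums to
    [2 a_k].  So run [k] changes [B] by [2 a_k] when [k] is odd and by [- 2 a_k]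
    when [k] is even, whence at the end of run [m]

      [B = 2 A m],  where  [A m = a_1 - a_2 + a_3 - ... + (-1)^(m-1) a_m]

    ([balance_run_end]).  Inside a run [B] is monotone, so it suffices to show
    [0 <= A m <= 2] for every [m].

    The sum [A] is in turn computed along the runs.  In a run of equal letters
    its signs cancel in pairs.  A run of ones has even length [2 a_k] and does
    not change [A]; a run of two twos does not either.  A single 2 changes [A]
    by 2, positively at an odd position and negatively at an even one.  Only
    these singletons change the parity of the position, so the signs of their
    contributions alternate: at the end of a run finishing at position [p],
    [A p] is 0 or 2 according to the parity of [p] ([altsum_run_end]).  Within
    a run [A] moves only between that value and one letter towards the other,
    which gives the bound ([altsum_bounds]), hence [balance_bounds] and, after
    division by [n], the limit.

    The sequence exists and is unique because run [n + 1] is determined by the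
    runs before it: they already contain the term of index [n + 1], except for
    [n = 0], where that term is 1 by requirement. *)

(** * The shape of the runs *)

Lemma is_run_functional a i j j' : is_run a i j -> is_run a i j' -> j = j'.
Proof.
move=> [/andP[_ ij] aij _ aj] [/andP[_ ij'] aij' _ aj'].
case: (ltngtP j j') => // lt_jj'.
- by case: aj; apply: aij'; rewrite lt_jj' ltnW.
- by case: aj'; apply: aij; rewrite lt_jj' ltnW.
Qed.

Lemma nth_run_is_run a n i j : nth_run a n i j -> is_run a i j.
Proof. by case. Qed.

Lemma nth_run_gt0 a n i j : nth_run a n i j -> 0 < n.
Proof. by case. Qed.

Lemma nth_run_inv a n j k : nth_run a n.+1 j k ->
  if n is 0 then j = 1 else exists i, nth_run a n i j.
Proof.
move=> r; inversion r as [|m i j' k' r']; subst; first by [].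
by case: n r r' => [_ /nth_run_gt0|n _ r'] //; exists i.
Qed.

Lemma nth_run_functional a n i j i' j' :
  nth_run a n i j -> nth_run a n i' j' -> i = i' /\ j = j'.
Proof.
move=> r; elim: r i' j' => [{}j rj|{}n {}i {}j k r IH rk] i' j' r'.
  have i'1 := nth_run_inv r'; split=> //.
  by move: (nth_run_is_run r'); rewrite i'1; apply: is_run_functional.
case: n r IH r' => [/nth_run_gt0 //|n] r IH r'.
have [i0 r0] := nth_run_inv r'.
have [_ jE] := IH _ _ r0; split=> //.
by move: (nth_run_is_run r'); rewrite -jE; apply: is_run_functional.
Qed.

Definition run_letter n := if odd n then 1 else 2.

(** The length that gives a run of [run_letter n] the sum [2 * x]. *)
Definition run_length n x := if odd n then 2 * x else x.

Section Runs.

Variable a : nat -> nat.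
Hypothesis a_cloitre : is_cloitre a.

Lemma cloitre_letter n i j : nth_run a n i j ->
  forall k, i <= k < j -> a k = run_letter n.
Proof.
have [a12 a1 _] := a_cloitre.
elim=> [{}j [_ aj _ _]|{}n {}i {}j k r IH rk] m im; first by rewrite aj.
have [/andP[i_gt0 ij] _ _ aj] := nth_run_is_run r.
have ai := IH i; rewrite leqnn ij in ai.
have [/andP[j_gt0 _] /(_ m im) -> _ _] := rk.
move: aj; rewrite (ai erefl) /run_letter /=.
by case: (a12 j j_gt0) => ->; case: odd.
Qed.

Lemma cloitre_end n i j : nth_run a n i j -> j = i + run_length n (a n).
Proof.
move=> r; have [_ _ /(_ n (nth_run_gt0 r)) [i' [j' [r']]]] := a_cloitre.
have [<- <-] := nth_run_functional r r'.
have [/andP[_ ij] _ _ _] := nth_run_is_run r.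
rewrite (eq_big_nat _ _ (cloitre_letter r)) sum_nat_const_nat.
by rewrite /run_letter /run_length; case: odd; lia.
Qed.

(** Self-reference looks backwards: run 1 has two terms and every later run at
    least one, so the term that governs run [n + 1] lies in the first [n] runs. *)
Lemma index_lt_run_end n i j : nth_run a n i j -> n.+1 < j.
Proof.
elim=> [{}j rj|{}n {}i {}j k _ IH [/andP[_ jk] _ _ _]]; last exact: leq_ltn_trans jk.
have [_ a1 _] := a_cloitre.
by rewrite (cloitre_end (first_run rj)) a1.
Qed.

Lemma in_some_run k : 0 < k -> exists n i j, nth_run a n i j /\ i <= k < j.
Proof.
move=> k_gt0.
suff cover n i j : nth_run a n i j -> k < j ->
    exists m i' j', nth_run a m i' j' /\ i' <= k < j'.
  have [_ _ /(_ k k_gt0) [i [j [r _]]]] := a_cloitre.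
  by apply: (cover _ _ _ r); exact: ltnW (index_lt_run_end r).
elim=> [{}j rj kj|{}n {}i {}j l r IH rl kl].
  by exists 1, 1, j; split; [exact: first_run|rewrite k_gt0].
case: (ltnP k j) => [/IH //|jk].
by exists n.+1, j, l; split; [exact: next_run r rl|rewrite jk].
Qed.

End Runs.

(** The induction goes over runs, not positions: agreement up to the end of run
    [n] covers the term of index [n + 1], which fixes the length of the next run. *)
Lemma cloitre_agree a b n i j : is_cloitre a -> is_cloitre b ->
  nth_run a n i j ->
  nth_run b n i j /\ forall k, 0 < k < j -> b k = a k.
Proof.
move=> ca cb; have [_ a1 _] := ca; have [_ b1 b_runs] := cb.
elim=> [{}j rj|{}n {}i {}j k r [rb IH] rk].
  have [i' [j' [rb _]]] := b_runs 1 erefl.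
  have i'1 := nth_run_inv rb; rewrite i'1 in rb.
  have ra := first_run rj.
  have jj' : j = j' by rewrite (cloitre_end ca ra) (cloitre_end cb rb) a1 b1.
  rewrite jj' in ra *; split=> // k k_in.
  by rewrite (cloitre_letter ca ra) ?(cloitre_letter cb rb).
have ra := next_run r rk.
have [j' [k' [rb' _]]] := b_runs n.+1 erefl.
have [i1 rb1] : exists i1, nth_run b n i1 j'.
  by case: n r rb' {rb} IH rk ra => [/nth_run_gt0|n _ /nth_run_inv].
have [_ jE] := nth_run_functional rb rb1; rewrite -jE in rb'.
have kk' : k = k'.
  rewrite (cloitre_end ca ra) (cloitre_end cb rb') IH //.
  exact: (index_lt_run_end ca r).
rewrite kk' in ra *; split=> // l /andP[l_gt0 lk].
case: (ltnP l j) => [lj|jl]; first by apply: IH; rewrite l_gt0.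
by rewrite (cloitre_letter ca ra) ?(cloitre_letter cb rb') ?jl.
Qed.

Lemma cloitre_unique a b : is_cloitre a -> is_cloitre b ->
  forall n, 0 < n -> b n = a n.
Proof.
move=> ca cb n n_gt0; have [m [i [j [r /andP[_ nj]]]]] := in_some_run ca n_gt0.
by have [_ -> //] := cloitre_agree ca cb r; rewrite n_gt0.
Qed.

(** * Existence *)

(** The concatenation of the first [n] runs.  The default value 1 of [nth] is read
    only for [m = 0], where it stands for the first term of the sequence. *)
Fixpoint run_word n : seq nat :=
  if n is m.+1 then
    run_word m ++ nseq (run_length n (nth 1 (run_word m) m)) (run_letter n)
  else [::].

(** The diagonal of the growing words; any [run_word n] long enough would give the
    same term ([cloitre_seqE]). *)
Definition cloitre_seq k := nth 0 (run_word k) k.-1.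

Lemma run_letter12 n : run_letter n = 1 \/ run_letter n = 2.
Proof. by rewrite /run_letter; case: odd; [left|right]. Qed.

Lemma nth_run_word12 x n k : x = 1 \/ x = 2 ->
  nth x (run_word n) k = 1 \/ nth x (run_word n) k = 2.
Proof.
move=> x12; elim: n k => [|n IH] k /=; first by rewrite nth_nil.
rewrite nth_cat; case: ifP => // _.
by rewrite nth_nseq; case: ifP => // _; exact: run_letter12.
Qed.

Lemma size_run_wordS n : size (run_word n) < size (run_word n.+1).
Proof.
rewrite /= size_cat size_nseq -[X in X < _]addn0 ltn_add2l /run_length.
by case: (@nth_run_word12 1 n n) => [|->|->]; [left|case: ifP|case: ifP].
Qed.

Lemma index_lt_size_run_word n : 0 < n -> n < size (run_word n).
Proof.
case: n => // n _; elim: n => // n IH.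
exact: leq_ltn_trans IH (size_run_wordS n.+1).
Qed.

Lemma nth_run_word_stable x m n k : m <= n -> k < size (run_word m) ->
  nth x (run_word n) k = nth x (run_word m) k.
Proof.
move=> + km; elim: n => [|n IH]; first by rewrite leqn0 => /eqP ->.
rewrite leq_eqVlt => /predU1P[-> //|]; rewrite ltnS => mn.
rewrite /= nth_cat IH // ifT //; apply: leq_trans km _.
elim: n mn {IH} => [|n IH]; first by rewrite leqn0 => /eqP ->.
rewrite leq_eqVlt => /predU1P[-> //|]; rewrite ltnS => /IH mn.
exact: leq_trans mn (ltnW (size_run_wordS n)).
Qed.

Lemma cloitre_seqE x n k : 0 < k <= size (run_word n) ->
  cloitre_seq k = nth x (run_word n) k.-1.
Proof.
move=> /andP[k_gt0 kn]; have kk := index_lt_size_run_word k_gt0.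
have kn' : k.-1 < size (run_word n) by rewrite prednK.
have kk' : k.-1 < size (run_word k) by apply: leq_ltn_trans kk; exact: leq_pred.
rewrite (set_nth_default 0 x kn') /cloitre_seq.
by case: (leqP n k) => [nk|/ltnW nk]; rewrite (nth_run_word_stable _ nk).
Qed.

Lemma cloitre_seq_letter n k : size (run_word n) < k <= size (run_word n.+1) ->
  cloitre_seq k = run_letter n.+1.
Proof.
case/andP=> nk kn; have k_gt0 : 0 < k by apply: leq_ltn_trans nk.
rewrite (@cloitre_seqE 0 n.+1) ?k_gt0 //=.
rewrite nth_cat ifF ?nth_nseq ?ifT //; last by lia.
by move: kn; rewrite /= size_cat size_nseq; lia.
Qed.

Lemma size_run_wordE n :
  size (run_word n.+1) = size (run_word n) + run_length n.+1 (cloitre_seq n.+1).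
Proof.
rewrite /= size_cat size_nseq; case: n => [//|n].
by rewrite (@cloitre_seqE 1 n.+1) // index_lt_size_run_word.
Qed.

Lemma cloitre_seq_is_run n :
  is_run cloitre_seq (size (run_word n)).+1 (size (run_word n.+1)).+1.
Proof.
have lt_n := size_run_wordS.
have start m : cloitre_seq (size (run_word m)).+1 = run_letter m.+1.
  by apply: cloitre_seq_letter; rewrite leqnn lt_n.
split.
- by apply/andP; split=> //; rewrite ltnS lt_n.
- by move=> k; rewrite start ltnS; apply: cloitre_seq_letter.
- case: n => [|n]; [by left|right]; rewrite start.
  rewrite (@cloitre_seq_letter n) ?lt_n ?leqnn //.
  by rewrite /run_letter /=; case: odd.
- by rewrite !start /run_letter /=; case: odd.
Qed.

Lemma cloitre_seq_nth_run n :
  nth_run cloitre_seq n.+1 (size (run_word n)).+1 (size (run_word n.+1)).+1.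
Proof.
elim: n => [|n IH]; first exact: first_run (cloitre_seq_is_run 0).
exact: next_run IH (cloitre_seq_is_run n.+1).
Qed.

Lemma cloitre_seq_cloitre : is_cloitre cloitre_seq.
Proof.
split=> // [n n_gt0|[//|n] _].
  rewrite (@cloitre_seqE 1 n); first by apply: nth_run_word12; left.
  by rewrite n_gt0 ltnW // index_lt_size_run_word.
exists (size (run_word n)).+1, (size (run_word n.+1)).+1.
split; first exact: cloitre_seq_nth_run.
rewrite (eq_big_nat _ _ (F2 := fun=> run_letter n.+1)) => [|k]; last first.
  by rewrite ltnS; apply: cloitre_seq_letter.
rewrite sum_nat_const_nat size_run_wordE.
by rewrite /run_letter /run_length; case: odd; lia.
Qed.

(** * The balance of ones and twos *)

Local Open Scope ring_scope.

Definition balance (a : nat -> nat) (n : nat) : int :=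
  3 * (ones a n)%:Z - 2 * n%:Z.

Fixpoint altsum (a : nat -> nat) (n : nat) : int :=
  if n is m.+1 then altsum a m + (-1) ^+ m * (a n)%:Z else 0.

Lemma balanceS a n :
  balance a n.+1 = balance a n + (if a n.+1 == 1%N then 1 else - 2).
Proof.
rewrite /balance /ones -[X in iota 1 X]addn1 iotaD map_cat count_cat /= add1n addn0.
by case: eqP => _ /=; lia.
Qed.

Section Balance.

Variable a : nat -> nat.
Hypothesis a_cloitre : is_cloitre a.

(** In a constant stretch the signs cancel in pairs, so only the parity of its
    length matters. *)
Lemma altsum_in_run n i j t : nth_run a n i.+1 j -> (i + t < j)%N ->
  altsum a (i + t) = altsum a i + (-1) ^+ i * (odd t * run_letter n)%N%:Z.
Proof.
move=> r; elim: t => [|t IH] tj; first by rewrite addn0 mulr0 addr0.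
rewrite addnS /= IH; last by lia.
rewrite (cloitre_letter a_cloitre r); last by lia.
rewrite exprD -signr_odd -[in (-1) ^+ t]signr_odd.
by case: (odd i); case: (odd t) => /=; rewrite ?expr0 ?expr1; lia.
Qed.

(** Only a run of odd length can change the sum, and such a run is a single 2: it
    moves the sum from one of 0 and 2 to the other, just as it flips the parity
    of the position. *)
Lemma altsum_run_end n i j : nth_run a n i j ->
  altsum a i.-1 = (2 * odd i.-1)%N /\ altsum a j.-1 = (2 * odd j.-1)%N.
Proof.
have step m i' j' : nth_run a m i'.+1 j' -> altsum a i' = (2 * odd i')%N ->
    altsum a j'.-1 = (2 * odd j'.-1)%N.
  move=> r Ai; have jE := cloitre_end a_cloitre r.
  rewrite jE addSn /= (altsum_in_run r) ?jE ?addSn // Ai oddD -signr_odd.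
  rewrite /run_length /run_letter; case: (odd m); rewrite ?oddM /=.
    by case: (odd i') => /=; lia.
  by case: (odd i'); case: (odd (a m)) => /=; rewrite ?expr0 ?expr1; lia.
elim=> [{}j rj|{}n {}i {}j k r [_ Aj] rk].
  by split=> //; apply: step (first_run rj) _.
split=> //; have [/andP[j_gt0 _] _ _ _] := rk.
by apply: (step n.+1 j.-1) => //; rewrite prednK //; exact: next_run r rk.
Qed.

(** From a run boundary, where the value is 0 or 2, the sum alternates with step 1
    or 2 towards the other end of the interval. *)
Lemma altsum_bounds k : 0 <= altsum a k <= 2.
Proof.
case: k => [//|k].
have [n [i [j [r /andP[ik kj]]]]] := in_some_run a_cloitre (ltn0Sn k).
have [Ai _] := altsum_run_end r.
have [/andP[i_gt0 _] _ _ _] := nth_run_is_run r.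
case: i i_gt0 => // i _ in r ik Ai *.
rewrite -(subnKC (ltnW ik)) (altsum_in_run r) ?subnKC //; last exact: ltnW.
rewrite Ai /= -signr_odd /run_letter.
by case: (odd i); case: (odd (_ - _)); case: (odd n) => /=;
  rewrite ?expr0 ?expr1; lia.
Qed.

Lemma balance_in_run n i j t : nth_run a n i.+1 j -> (i + t < j)%N ->
  balance a (i + t) = balance a i + (if odd n then t%:Z else - (2 * t)%N%:Z).
Proof.
move=> r; elim: t => [|t IH] tj; first by rewrite addn0; case: odd; rewrite addr0.
rewrite addnS balanceS IH; last by lia.
rewrite (cloitre_letter a_cloitre r); last by lia.
by rewrite /run_letter; case: odd => /=; lia.
Qed.

(** Run [n] contributes its sum [2 * a n] when made of ones, and the opposite of
    its sum when made of twos. *)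
Lemma balance_run_end n i j : nth_run a n i j ->
  balance a i.-1 = 2 * altsum a n.-1 /\ balance a j.-1 = 2 * altsum a n.
Proof.
have step m i' j' : nth_run a m i'.+1 j' ->
    balance a i' = 2 * altsum a m.-1 -> balance a j'.-1 = 2 * altsum a m.
  move=> r Bi; have jE := cloitre_end a_cloitre r.
  rewrite jE addSn /= (balance_in_run r) ?jE ?addSn // Bi.
  case: m r {jE Bi} => [/nth_run_gt0 //|m] _.
  rewrite /run_length /= -signr_odd.
  by case: (odd m); rewrite ?expr0 ?expr1 /=; lia.
elim=> [{}j rj|{}n {}i {}j k r [_ Bj] rk].
  by split=> //; apply: step (first_run rj) _.
split=> //; have [/andP[j_gt0 _] _ _ _] := rk.
by apply: (step n.+1 j.-1) => //; rewrite prednK //; exact: next_run r rk.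
Qed.

(** Monotone inside each run, the balance lies between its values at the two ends
    of the run, which are twice values of [altsum]. *)
Lemma balance_bounds k : 0 <= balance a k <= 4.
Proof.
case: k => [//|k].
have [n [i [j [r /andP[ik kj]]]]] := in_some_run a_cloitre (ltn0Sn k).
have [Bi Bj] := balance_run_end r.
have [/andP[i_gt0 _] _ _ _] := nth_run_is_run r.
case: i i_gt0 => // i _ in r ik Bi *; rewrite /= in Bi.
have := altsum_bounds n; have := altsum_bounds n.-1.
have Bk := @balance_in_run n i j (k.+1 - i) r.
have Be := @balance_in_run n i j (j.-1 - i) r.
move: Bk Be; rewrite !subnKC; try lia.
move=> /(_ kj) -> /(_ ltac:(lia)); rewrite Bi Bj.
by case: odd; lia.
Qed.

End Balance.

Lemma cvg_ratio_of_bounded (R : realType) (u : nat -> nat) (p q C : nat) :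
  (0 < q)%N ->
  (forall n, 0 <= q%:Z * (u n)%:Z - p%:Z * n%:Z <= C%:Z) ->
  ((fun n => (u n)%:R / n%:R : R) @ \oo --> (p%:R / q%:R : R))%classic.
Proof.
move=> q_gt0 u_bd; apply/cvgrPdist_le => e e_gt0; near=> n.
have q0 : 0 < q%:R :> R by rewrite ltr0n.
have n0 : 0 < n%:R :> R by rewrite ltr0n; near: n; exists 1%N.
pose d : R := q%:R * (u n)%:R - p%:R * n%:R.
have [lo hi] : 0 <= d /\ d <= C%:R.
  have /andP[lo hi] := u_bd n; rewrite /d.
  by rewrite -!natrM subr_ge0 lerBlDr -natrD !ler_nat; lia.
have ne : C%:R / e <= n%:R by near: n; exact: nbhs_infty_ger.
have Cne : C%:R <= e * (n%:R * q%:R).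
  rewrite mulrA; apply: le_trans (_ : e * n%:R <= _).
    by rewrite mulrC -ler_pdivrMr.
  by apply: ler_peMr; rewrite ?ler1n // mulr_ge0 // ltW.
rewrite distrC ger0_norm.
  have -> : (u n)%:R / n%:R - p%:R / q%:R
      = d / (n%:R * q%:R) :> R.
    by rewrite /d; field; rewrite !lt0r_neq0.
  by rewrite ler_pdivrMr ?mulr_gt0 //; exact: le_trans hi Cne.
by rewrite subr_ge0 ler_pdivrMr // mulrAC ler_pdivlMr // [leRHS]mulrC -subr_ge0.
Unshelve. all: by end_near. Qed.

Local Open Scope classical_set_scope.
Local Open Scope ring_scope.

Theorem theorem2 (R : realType) :
  (exists a : nat -> nat,
     is_cloitre a /\
     forall b : nat -> nat, is_cloitre b -> forall n : nat, (0 < n)%N -> b n = a n) /\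
  (forall a : nat -> nat, is_cloitre a ->
     (forall n : nat, 0 <= 3 * (ones a n)%:Z - 2 * n%:Z <= 4) /\
     ((fun n : nat => (ones a n)%:R / n%:R : R) @ \oo --> (2 / 3 : R))).
Proof.
split.
  exists cloitre_seq; split=> [|b cb]; first exact: cloitre_seq_cloitre.
  exact: cloitre_unique cloitre_seq_cloitre cb.
move=> a ca; split=> [n|]; first exact: balance_bounds.
apply: (@cvg_ratio_of_bounded R (ones a) 2 3 4) => // n.
exact: balance_bounds.
Qed.
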